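(* Let $\mathcal T$ be a set of tile designs for the regular tetrahedron with symmetry group the rotational tetrahedral group $T$ (order $12$). Suppose there are $t_{\mathrm{id}}$ tiles, $t_r$ of which are fixed under $120^\circ$ rotation of the triangular face. Then the number of ways of tiling the faces of the tetrahedron up to rotational tetrahedral symmetry $T$ is $$\frac{1}{12}\left(t_{\mathrm{id}}^4+8\,t_{\mathrm{id}}t_r+3\,t_{\mathrm{id}}^2\right).$$
   Context: Tilings. Let $P$ be a polyhedron with set of faces $\mathcal F$ and let $\mathcal A$ be a group of isometries of $P$, acting on $\mathcal F$. A set of tile designs is a finite set $\mathcal T$ together with a group action of $\mathcal A$ on $\mathcal T\times\mathcal F$ lying over the action on $\mathcal F$ (so $A\cdot(D,F)=(D',A\cdot F)$ for some $D'\in\mathcal T$). A tiling is a map $\tau:\mathcal F\to\mathcal T$; $\mathcal A$ acts on tilings by moving graphs: $A\cdot\tau$ is the tiling with $((A\cdot\tau)(A\cdot F),A\cdot F)=A\cdot(\tau(F),F)$ for all $F$. The number of ways of tiling up to $\mathcal A$ is the number of $\mathcal A$-orbits on the set of tilings. The induced symmetry group $G$ of a face $F$ is the group of isometries of $F$ realized by elements of the stabilizer $\mathcal A_F$; for $g\in G$, $t_g$ is the number of $D\in\mathcal T$ with $g\cdot(D,F)=(D,F)$, where $g$ acts via the element of $\mathcal A_F$ inducing it. Since $\mathcal A$ acts transitively on faces, $t_g$ does not depend on the choice of $F$. In particular $t_{\mathrm{id}}=|\mathcal T|$. Polyhedron and group. Let $T_d$ be the group of order $24$ generated by the matrices $R_0=\begin{pmatrix}0&1&0\\1&0&0\\0&0&1\end{pmatrix}$,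 $R_1=\begin{pmatrix}1&0&0\\0&0&1\\0&1&0\end{pmatrix}$, $R_2=\begin{pmatrix}0&-1&0\\-1&0&0\\0&0&1\end{pmatrix}$. Here $\mathcal A=T=\{A\in T_d:\det A=1\}$, of order $12$. The tetrahedron is the convex hull of the $T_d$-orbit of $(1,1,1)$ ($4$ vertices, $4$ equilateral triangular faces). The symmetry group that $T$ induces on a face is the cyclic group generated by a $120^\circ$ rotation $r$. *)

(* Defs.v *)
From mathcomp Require Import all_boot all_order all_algebra.
From mathcomp Require Import all_classical all_reals all_analysis.

Set Implicit Arguments.
Unset Strict Implicit.
Unset Printing Implicit Defensive.

Import Order.TTheory GRing.Theory Num.Theory.

Local Open Scope classical_set_scope.
Local Open Scope ring_scope.

Definition dot {R : realType} (x y : 'cV[R]_3) : R :=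
  \sum_(i < 3) x i 0 * y i 0.

(** Polyhedra and their faces *)

Definition convex_hull {R : realType} (S : set 'cV[R]_3) : set 'cV[R]_3 :=
  smallest (@convex_set R 'cV[R]_3) S.

(* Two-dimensional faces: intersections of [P] with a supporting plane that
   contain three affinely independent points. *)
Definition is_face {R : realType} (P F : set 'cV[R]_3) : Prop :=
  (exists (a : 'cV[R]_3) (b : R),
     [/\ a != 0,
         forall x, P x -> dot a x <= b
       & F = [set x | P x /\ dot a x = b]])
  /\ (exists x y z, [/\ F x, F y, F z &
        \rank (row_mx (y - x) (z - x)) = 2%N]).

Definition face {R : realType} (P : set 'cV[R]_3) : Type :=
  {F : set 'cV[R]_3 | is_face P F}.

(** Tilings, for a group [G] of matrices acting on column vectors *)

Definition matrix_group {R : realType} (G : set 'M[R]_3) : Prop :=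
  [/\ forall A, G A -> A \in unitmx,
      G 1%:M,
      forall A B, G A -> G B -> G (A *m B)
    & forall A, G A -> G (invmx A)].

(* The axioms constrain [act A] only for [A] in [G]; its values elsewhere are
   irrelevant. *)
Record tile_designs {R : realType} (G : set 'M[R]_3) (P : set 'cV[R]_3)
    (D : finType) := TileDesigns {
  act : 'M[R]_3 -> D * face P -> D * face P;
  act1 : forall p, act 1%:M p = p;
  actM : forall A B p, G A -> G B -> act (A *m B) p = act A (act B p);
  act_face : forall A p, G A ->
    sval (act A p).2 = [set A *m x | x in sval p.2]
}.

Section Tilings.
Context {R : realType} {G : set 'M[R]_3} {P : set 'cV[R]_3} {D : finType}.
Variable S : tile_designs G P D.

Definition tiling : Type := face P -> D.

Definition graph (tau : tiling) : set (D * face P) :=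
  [set (tau F, F) | F in [set: face P]].

Definition tiling_orbit (tau : tiling) : set tiling :=
  [set tau' | exists2 A, G A & graph tau' = act S A @` graph tau].

Definition tiling_orbits : set (set tiling) :=
  [set tiling_orbit tau | tau in [set: tiling]].

End Tilings.

(** Induced symmetries of a face *)

Definition induces {R : realType} (G : set 'M[R]_3) (F : set 'cV[R]_3)
    (A : 'M[R]_3) (g : F -> F) : Prop :=
  [/\ G A, [set A *m x | x in F] = F & forall x : F, \val (g x) = A *m \val x].

Definition induced_symmetry {R : realType} (G : set 'M[R]_3)
    (F : set 'cV[R]_3) (g : F -> F) : Prop :=
  exists A, induces G A g.

(* [fixed_designs S g] is the set counted by t_g. *)
Definition fixed_designs {R : realType} {G : set 'M[R]_3} {P : set 'cV[R]_3}
    {D : finType} (S : tile_designs G P D) (F : face P)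
    (g : sval F -> sval F) : {set D} :=
  [set d : D | `[< exists A, induces G A g /\ act S A (d, F) = (d, F) >]].

(* In some orthonormal frame [(c; u, v)] of the plane of [F], [g] is the
   rotation about [c] by the angle [theta]. The frame carries no preferred
   orientation, so both senses of rotation are covered. *)
Definition rotation_by {R : realType} (theta : R) (F : set 'cV[R]_3)
    (g : F -> F) : Prop :=
  exists c u v : 'cV[R]_3,
    [/\ dot u u = 1, dot v v = 1, dot u v = 0 &
      forall x : F, exists a b : R,
        \val x = c + a *: u + b *: v /\
        \val (g x) = c + (a * cos theta - b * sin theta) *: u
                       + (a * sin theta + b * cos theta) *: v].

(** The regular tetrahedron and its rotation group *)

Definition matrix_of_rows {R : realType} (s : seq (seq R)) : 'M[R]_3 :=
  \matrix_(i < 3, j < 3) nth 0 (nth [::] s i) j.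

Definition R0 (R : realType) : 'M[R]_3 := matrix_of_rows
  [:: [:: 0; 1; 0];
      [:: 1; 0; 0];
      [:: 0; 0; 1]].

Definition R1 (R : realType) : 'M[R]_3 := matrix_of_rows
  [:: [:: 1; 0; 0];
      [:: 0; 0; 1];
      [:: 0; 1; 0]].

Definition R2 (R : realType) : 'M[R]_3 := matrix_of_rows
  [:: [::  0; -1; 0];
      [:: -1;  0; 0];
      [::  0;  0; 1]].

Arguments R0 : clear implicits.
Arguments R1 : clear implicits.
Arguments R2 : clear implicits.

Definition Td (R : realType) : set 'M[R]_3 :=
  smallest matrix_group [set A | A = R0 R \/ A = R1 R \/ A = R2 R].

Arguments Td : clear implicits.

Definition T (R : realType) : set 'M[R]_3 := [set A | Td R A /\ \det A = 1].

Arguments T : clear implicits.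

Definition tetrahedron (R : realType) : set 'cV[R]_3 :=
  convex_hull [set A *m const_mx 1 | A in Td R].

Arguments tetrahedron : clear implicits.

(* Main.v *)
Require Import Defs.
From mathcomp Require Import all_boot all_order all_algebra.
From mathcomp Require Import fingroup perm action cyclic primitive_action alt.
From mathcomp Require Import all_classical all_reals all_analysis.
From mathcomp Require Import ring lra.

Import Order.TTheory GRing.Theory Num.Theory.

Set Implicit Arguments.
Unset Strict Implicit.
Unset Printing Implicit Defensive.

(** The count is Burnside's lemma for the group T acting on tilings, once T is
    recognized as the alternating group on the four vertices.

    Geometry. The vertices v_0, ..., v_3 of the tetrahedron sum to 0 and form a
    tight frame: 4 x is the sum of the <v_i, x> v_i. Hence every permutation s
    of the vertices is realized by exactly one matrix, the sum of the
    v_(s i) v_i^T divided by 4 ([vperm]). The generators of Td are transpositions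
    of determinant -1, so that Td is the image of the symmetric group and T that
    of the alternating group ([TE]). The frame also provides barycentric
    coordinates, (<v_i, x> + 1) / 4, which describe the tetrahedron by four
    inequalities ([tetrahedronP]) and show that its faces are the four facets
    <v_i, x> = -1, each opposite to one vertex ([face_is_facet]). Therefore T
    permutes the faces as it does the vertices, and a set of tile designs is a
    family of maps D -> D, one for each even permutation s and each i, leading
    from the designs on face i to the designs on face s i ([carry]).

    Combinatorics. A labelling fixed by a group H is determined by its values on
    a transversal of the H-orbits, and the value at i can be any label fixed by
    the stabilizer of i in H ([card_afix_relabel]). An even permutation s other
    than 1 always has exactly two cycles: their number is even, because s is even,
    and it is less than 4. If s has no fixed point, then <[s]> acts freely and
    s fixes |D|^2 labellings. Otherwise s has one fixed point i, one cycle being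
    free and the other reduced to i, and s fixes |D| t labellings, where t counts
    the labels at i fixed by s. This t is the same for all these s: stabilizers
    of points have order 3, so each is generated by any of its elements other
    than 1, and they are all conjugate. Burnside's lemma for the action on the
    points themselves gives 12 = 4 + #(s with one fixed point), so that there are
    8 elements of the second kind and 12 - 1 - 8 = 3 of the first.

    A rotation of a face by a third of a turn is not the identity, so it comes
    from one of these 8 elements ([rotation_vperm_neq1]), and it comes from only
    one, because three vertices determine a linear map ([induces_vperm]). Thus
    t_r is the number t above. *)

(** * Equivariant labellings *)

(** [I] carries an action of [G], and [al g i] transports the labels at [i] to
    the labels at [to i g]: this is an equivariant bundle over [I] with fibre [D].
    A labelling is a section of it. *)
Section EquivariantSections.
Import fintype mathcomp.boot.finset.
Local Open Scope group_scope.
Variables (gT : finGroupType) (I D : finType) (to : {action gT &-> I}).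
Variables (G : {group gT}) (al : gT -> I -> D -> D).
Hypothesis al1 : forall i d, al 1 i d = d.
Hypothesis alM : {in G &, forall g h i d,
  al (g * h) i d = al h (to i g) (al g i d)}.

(** Outside [G], where [al] is unconstrained, labellings are left unchanged: an
    action has to be injective for every element of the ambient type. *)
Definition relabel (f : {ffun I -> D}) g : {ffun I -> D} :=
  if g \in G then [ffun i => al g (to i g^-1) (f (to i g^-1))] else f.

Lemma relabelE f g i : g \in G -> relabel f g (to i g) = al g i (f i).
Proof. by move=> Gg; rewrite /relabel Gg ffunE actK. Qed.

Lemma relabel1 f : relabel f 1 = f.
Proof. by apply/ffunP=> i; rewrite -{1}[i](act1 to) relabelE ?al1. Qed.

Lemma relabelM f : {in G &, act_morph relabel f}.
Proof.
move=> g h Gg Gh; apply/ffunP=> i; rewrite -[i](actKV to (g * h)).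
by rewrite relabelE ?groupM // alM // actM !relabelE.
Qed.

Lemma relabel_is_action : is_action G relabel.
Proof.
split=> [g f f' | f]; last exact: relabelM.
have [Gg eq_ff | Gg] := boolP (g \in G); last by rewrite /relabel (negPf Gg).
by rewrite -(relabel1 f) -(relabel1 f') -(mulgV g) !relabelM ?groupV // eq_ff.
Qed.

Definition relabel_action := Action relabel_is_action.

Lemma afix_relabelP (H : {set gT}) (f : {ffun I -> D}) : H \subset G ->
  reflect {in H, forall g i, f (to i g) = al g i (f i)}
          (f \in 'Fix_relabel_action(H)).
Proof.
move=> sHG; apply: (iffP afixP) => fixf g Hg.
  by move=> i; rewrite -relabelE ?(subsetP sHG) // [relabel _ _]fixf.
change (relabel f g = f); apply/ffunP=> i; rewrite -[i](actKV to g).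
by rewrite relabelE ?(subsetP sHG) ?(fixf g).
Qed.

Definition fixed_labels (H : {set gT}) i : {set D} :=
  [set d | [forall g in 'C_H[i | to], al g i d == d]].

(** An invariant section is determined by its values on a transversal, since
    [f (to i g) = al g i (f i)]. Conversely this formula is a consistent
    definition of [f] as soon as the label chosen at each representative [i] is
    fixed by the stabilizer of [i]. *)
Lemma card_afix_relabel (H : {group gT}) : 0 < #|D| -> H \subset G ->
  #|'Fix_relabel_action(H)| =
  (\prod_(i in orbit_transversal to H [set: I]) #|fixed_labels H i|)%N.
Proof.
case/card_gt0P=> d0 _ sHG; set X := orbit_transversal _ _ _.
have actsT: [acts H, on [set: I] | to] by apply/actsP=> g _ i; rewrite !inE.
have [_ _ Xinj Xrep] := orbit_transversalP actsT; rewrite -/X in Xinj Xrep.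
(* [d0] pads the restriction to [X] into a total function, as [pfamily] wants *)
pose res (f : {ffun I -> D}) := [ffun i => if i \in X then f i else d0].
have resE f i : i \in X -> res f i = f i by rewrite ffunE => ->.
rewrite -big_enum /= -(big_map (fun i => #|fixed_labels H i|) xpredT id).
rewrite -foldrE -(card_pfamily d0).
rewrite -(card_in_imset (f := res)); last first.
  move=> f f' /afix_relabelP-/(_ sHG) fixf /afix_relabelP-/(_ sHG) fixf' eq_res.
  apply/ffunP=> i; have [g Hg Xgi] := Xrep i (in_setT i).
  rewrite -[i](actK to g) fixf ?groupV // -(resE f) // eq_res resE //.
  by rewrite -fixf' ?groupV.
apply: eq_card => h.
apply/imsetP/pfamilyP => [[f /afix_relabelP-/(_ sHG) fixf ->]|].
  split=> [|i Xi].
    by apply/subsetP=> i; rewrite inE ffunE; case: ifP => // _; rewrite eqxx.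
  rewrite inE resE //; apply/forall_inP=> g /setIP[Hg /astab1P gi].
  by rewrite -fixf // gi.
case=> h_supp h_lab.
have [a aH aX] : exists2 a : I -> gT, forall i, a i \in H
    & forall i, to i (a i) \in X.
  exact: (fin_all_exists2 (fun i => Xrep i (in_setT i))).
pose f := [ffun y => al (a y)^-1 (to y (a y)) (h (to y (a y)))].
have sH := subsetP sHG.
have fE x g : x \in X -> g \in H -> f (to x g) = al g x (h x).
  (* [g * b] stabilizes [x], hence fixes the label [h x] *)
  move=> Xx Hg; rewrite ffunE; set b := a _.
  have Hb : b \in H by apply: aH.
  have bx : to (to x g) b = x.
    apply/esym/eqP; rewrite -Xinj ?aX //.
    by rewrite -actM mem_orbit ?groupM.
  have : h x \in fixed_labels H x by apply: h_lab.
  rewrite inE => /forall_inP/(_ (g * b)).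
  have -> : g * b \in 'C_H[x | to].
    by rewrite inE groupM //=; apply/astab1P; rewrite actM.
  move=> /(_ isT)/eqP hx; rewrite bx -{1}hx -{1}bx -actM -alM ?mulgK //.
    by rewrite sH ?groupM.
  by rewrite groupV sH.
exists f.
  apply/afix_relabelP=> // g Hg y; rewrite -[y](actK to (a y)) -actM.
  by rewrite !fE ?groupM ?groupV // alM ?sH ?groupV.
apply/ffunP=> x; have [Xx | nXx] := boolP (x \in X).
  by rewrite resE // -[x in RHS](act1 to) fE // al1.
rewrite ffunE (negPf nXx); apply/eqP; apply: contraR nXx => hx.
by apply: (subsetP h_supp); rewrite inE.
Qed.

(** The stabilizers of [i] and [to i g] are conjugate by [g], and [al g i] is a
    bijection between the labels that they fix. *)
Lemma card_fixed_labels_act g i : g \in G ->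
  #|fixed_labels G (to i g)| = #|fixed_labels G i|.
Proof.
have le_card h j :
    h \in G -> #|fixed_labels G j| <= #|fixed_labels G (to j h)|.
  move=> Gh; have al_inj : injective (al h j).
    apply: (can_inj (g := al h^-1 (to j h))) => d.
    by rewrite -alM ?groupV // mulgV al1.
  rewrite -(card_imset _ al_inj); apply/subset_leq_card/subsetP=> e.
  case/imsetP=> d + ->{e}.
  rewrite !inE => /forall_inP fix_d; apply/forall_inP=> k.
  case/setIP=> Gk /astab1P jhk.
  have /fix_d/eqP : k ^ h^-1 \in 'C_G[j | to].
    rewrite inE groupJ ?groupV //=; apply/astab1P.
    by rewrite conjgE invgK !actM jhk actK.
  rewrite conjgE invgK alM ?groupM ?groupV // => fix_hd.
  have back : to (to j h) (k * h^-1) = j by rewrite actM jhk actK.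
  have Gkh : k * h^-1 \in G by rewrite groupM ?groupV.
  have := alM Gkh Gh (to j h) (al h j d).
  by rewrite mulgKV back fix_hd => ->.
move=> Gg; apply/eqP; rewrite eqn_leq le_card // andbT.
by rewrite -{2}[i](actK to g) le_card ?groupV.
Qed.

Lemma fixed_labels_trivg (H : {set gT}) i :
  'C_H[i | to] = 1 -> fixed_labels H i = [set: D].
Proof.
move=> stab1; apply/setP=> d; rewrite !inE stab1; apply/forall_inP=> g /set1P->.
by rewrite al1.
Qed.

Lemma fixed_labels_cycle g i : g \in 'C_G[i | to] ->
  fixed_labels <[g]> i = [set d | al g i d == d].
Proof.
case/setIP=> Gg /astab1P gi; apply/setP=> d; rewrite !inE.
apply/forall_inP/eqP => [fix_d | fix_d _ /setIP[/cycleP[n ->] _]].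
  by apply/eqP/fix_d; rewrite inE cycle_id; apply/astab1P.
elim: n => [|n IHn]; first by rewrite expg0 al1.
by rewrite expgS alM ?groupX // gi fix_d.
Qed.
End EquivariantSections.

(** * The alternating group on four points *)

Section Alt4.
Import fintype mathcomp.boot.finset.
Local Open Scope group_scope.
Local Notation A4 := ('Alt_('I_4)).

Lemma card_A4 : #|A4| = 12.
Proof.
have := @card_Alt 'I_4; rewrite card_ord => /(_ isT) card2.
by apply/eqP; rewrite -(eqn_pmul2l (isT : 0 < 2)) card2.
Qed.

Lemma A4_trans : [transitive A4, on setT | 'P].
Proof.
by have := Alt_trans 'I_4; rewrite card_ord; apply: ntransitive1.
Qed.

Lemma card_A4_stab i : #|'C_A4[i | 'P]| = 3.
Proof.
have := card_orbit_stab 'P A4 i; rewrite card_A4.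
rewrite (atransP A4_trans) ?inE // cardsT card_ord => card4.
by apply/eqP; rewrite -(eqn_pmul2l (isT : 0 < 4)) card4.
Qed.

(** A permutation that fixes [i] and [j] permutes the two other points, so it is
    either 1 or a transposition, which is odd. *)
Lemma A4_fix2_eq1 s i j : s \in A4 -> i != j -> s i = i -> s j = j -> s = 1.
Proof.
rewrite Alt_even => even_s ij si sj.
have : #|~: [set i; j]| == 2 by rewrite cardsCs setCK cards2 ij card_ord.
case/cards2P=> k [l [kl def_kl]].
have others x : x != i -> x != j -> x = k \/ x = l.
  move=> xi xj; have : x \in ~: [set i; j] by rewrite !inE negb_or xi.
  by rewrite def_kl !inE => /orP[] /eqP; [left | right].
have : k \in ~: [set i; j] by rewrite def_kl !inE eqxx.
have : l \in ~: [set i; j] by rewrite def_kl !inE eqxx orbT.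
rewrite !inE !negb_or => /andP[li lj] /andP[ki kj].
have sO x : x != i -> x != j -> s x = k \/ s x = l.
  move=> xi xj.
  by apply: others; [rewrite -si | rewrite -sj]; rewrite (inj_eq perm_inj).
case: (sO k ki kj) => sk.
  have sl : s l = l.
    case: (sO l li lj) => // slk; case/eqP: kl; apply: (@perm_inj _ s).
    by rewrite sk slk.
  apply/permP=> x; rewrite perm1.
  have [->//|xi] := eqVneq x i; have [->//|xj] := eqVneq x j.
  by case: (others x xi xj) => ->.
have sl : s l = k.
  case: (sO l li lj) => // sll; case/eqP: kl; apply: (@perm_inj _ s).
  by rewrite sk sll.
case/negP: even_s; suff -> : s = tperm k l by rewrite odd_tperm.
apply/permP=> x.
have [->|xi] := eqVneq x i; first by rewrite si tpermD.
have [->|xj] := eqVneq x j; first by rewrite sj tpermD.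
by case: (others x xi xj) => ->; rewrite ?tpermL ?tpermR.
Qed.

(** The sign of [s] is the parity of 4 minus its number of cycles, which is
    therefore even; only the identity has 4 cycles. *)
Lemma card_orbits_A4_cycle s :
  s \in A4 -> s != 1 -> #|orbit 'P <[s]> @: setT| = 2.
Proof.
rewrite Alt_even => even_s s_neq1.
have -> : #|orbit 'P <[s]> @: setT| = #|porbits s|.
  rewrite /porbits porbit.unlock; apply: eq_card => O.
  by apply/imsetP/imsetP=> -[x _ ->]; exists x.
have porbits_gt0 : 0 < #|porbits s|.
  by rewrite card_gt0; apply/set0Pn; exists (porbit s ord0); apply: imset_f.
have : #|porbits s| < 4.
  have := leq_imset_card (porbit s) 'I_4; rewrite card_ord ltn_neqAle => ->.
  rewrite andbT; apply: contra s_neq1 => /eqP card4.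
  have /imset_injP inj : #|porbit s @: 'I_4| == #|'I_4|.
    by apply/eqP; rewrite [LHS]card4 card_ord.
  apply/eqP/permP=> x; rewrite perm1.
  by apply: inj => //; rewrite -{2}[s]expg1 porbit_perm.
move: even_s porbits_gt0; rewrite /odd_perm card_ord /=.
by case: #|porbits s| => [|[|[|[|]]]].
Qed.

(** A power of [s] that fixes [i] also fixes [s i], a second point. *)
Lemma A4_stab_cycle s i : s \in A4 -> s i != i -> 'C_(<[s]>)[i | 'P] = 1.
Proof.
move=> As si; apply/trivgP/subsetP=> g /setIP[sg /astab1P gi].
have Ag : g \in A4 by apply: subsetP sg; rewrite cycle_subG.
rewrite inE; apply/eqP/(A4_fix2_eq1 Ag (i := i) (j := s i)) => //.
  by rewrite eq_sym.
case/cycleP: sg gi => n ->; rewrite /= /aperm => gi.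
by rewrite -!permM -expgS expgSr permM gi.
Qed.

(** The stabilizer has prime order 3. *)
Lemma A4_stab_gen s i : s \in 'C_A4[i | 'P] -> s != 1 -> <[s]> = 'C_A4[i | 'P].
Proof.
move=> Cs s_neq1; apply/eqP; rewrite eqEcard cycle_subG Cs card_A4_stab.
have /cardSg : <[s]> \subset 'C_A4[i | 'P] by rewrite cycle_subG.
rewrite card_A4_stab.
rewrite dvdn_divisors // !inE => /orP[|/eqP-> //].
by rewrite -[_ == 1%N]/(#[s] == 1%N) order_eq1 (negPf s_neq1).
Qed.

Lemma A4_fix_neq1 s : s \in A4 -> s != 1 ->
  #|'Fix_'P[s]| = [exists i, s i == i] :> nat.
Proof.
move=> As s_neq1; case: existsP => [[i /eqP si] | no_fix].
  apply/eqP/cards1P; exists i; apply/setP=> j; rewrite !inE sub1set inE.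
  apply/eqP/eqP=> [sj | -> //]; apply/eqP; apply: contraNT s_neq1 => ij.
  by rewrite (A4_fix2_eq1 As ij sj si).
apply/eqP; rewrite cards_eq0 -subset0; apply/subsetP=> i /afix1P si.
by case: no_fix; exists i; apply/eqP.
Qed.

(** Burnside's lemma for the transitive action on the 4 points reads
    [1 * 12 = 4 + N], where [N] is this number: 1 fixes 4 points and every other
    element fixes at most one. *)
Lemma A4_card_fix : #|[set s in A4 | (s != 1) && [exists i, s i == i]]| = 8.
Proof.
have := Frobenius_Cauchy (G := A4) (S := setT) (atrans_acts A4_trans).
rewrite card_A4.
have -> : #|[set orbit 'P A4 x | x in setT]| = 1%N.
  apply/eqP/cards1P; exists setT; apply/setP=> O; rewrite inE.
  apply/imsetP/eqP=> [[i _ ->] | ->]; first by rewrite (atransP A4_trans) ?inE.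
  by exists ord0; rewrite ?inE // (atransP A4_trans) ?inE.
rewrite (bigD1 1) ?group1 //= setTI.
have -> : 'Fix_'P[1] = [set: 'I_4].
  by apply/setP=> i; rewrite in_setT; apply/afix1P; rewrite /= /aperm perm1.
rewrite cardsT card_ord.
under eq_bigr => s /andP[As s_neq1] do rewrite setTI A4_fix_neq1 //.
rewrite -big_mkcondr sum1dep_card mul1n => /(can_inj (addKn 4)) <- /=.
by apply: eq_card => s; rewrite !inE andbA.
Qed.

Lemma A4_card_nofix :
  #|[set s in A4 | (s != 1) && ~~ [exists i, s i == i]]| = 3.
Proof.
have := cardsD1 1 A4; rewrite card_A4 group1.
rewrite -(cardsID [set s : {perm 'I_4} | [exists i, s i == i]] (A4 :\ 1)).
have -> : (A4 :\ 1) :&: [set s : {perm 'I_4} | [exists i, s i == i]] =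
    [set s in A4 | (s != 1) && [exists i, s i == i]].
  by apply/setP=> s; rewrite !inE; case: (s == 1); rewrite ?andbF //= -andbA.
(* 9 = 1 + 8 *)
rewrite A4_card_fix => /(can_inj (addKn 9)) eq3; apply: etrans (esym eq3).
apply: eq_card => s.
by rewrite !inE; case: (s == 1); rewrite ?andbF ?andbT //= andbC.
Qed.

(** * Labellings of four points up to even permutations *)

Section Count.
Variables (D : finType) (al : {perm 'I_4} -> 'I_4 -> D -> D).
Hypothesis al1 : forall i d, al 1 i d = d.
Hypothesis alM : {in A4 &, forall s t i d,
  al (s * t) i d = al t (s i) (al s i d)}.

Notation rl := (relabel_action (to := 'P) al1 alM).

Lemma card_afix1_relabel : #|'Fix_rl[1]| = (#|D| ^ 4)%N.
Proof.
have -> : 'Fix_rl[1] = setT.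
  by apply/setP=> f; rewrite in_setT; apply/afix1P; apply: relabel1.
by rewrite cardsT card_ffun card_ord.
Qed.

Section OneElement.
Variable s : {perm 'I_4}.
Hypotheses (D_gt0 : 0 < #|D|) (As : s \in A4) (s_neq1 : s != 1).
Let X := orbit_transversal 'P <[s]> [set: 'I_4].

Lemma card_afix_relabel_cycle : [/\ #|X| = 2,
  forall i, s i = i -> i \in X &
  #|'Fix_rl[s]| = (\prod_(i in X) #|fixed_labels 'P al <[s]> i|)%N].
Proof.
have sH : <[s]> \subset A4 by rewrite cycle_subG.
have actsT : [acts <[s]>, on [set: 'I_4] | 'P].
  by apply/actsP=> g _ i; rewrite !inE.
have [trX _ _ Xrep] := orbit_transversalP actsT; rewrite -/X in trX Xrep.
split.
- by rewrite (card_transversal trX) card_orbits_A4_cycle.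
- move=> i si; have [_ /cycleP[n ->] /=] := Xrep i (in_setT i).
  by rewrite /aperm permX iter_fix.
- by rewrite -afix_cycle_in // card_afix_relabel.
Qed.

Lemma card_afix_relabel_nofix : (forall i, s i != i) ->
  #|'Fix_rl[s]| = (#|D| ^ 2)%N.
Proof.
move=> no_fix; have [card2 _ ->] := card_afix_relabel_cycle.
transitivity (#|D| ^ #|X|)%N; last by rewrite card2.
rewrite -prod_nat_const.
by apply: eq_bigr => i _; rewrite fixed_labels_trivg ?A4_stab_cycle // cardsT.
Qed.

Lemma card_afix_relabel_stab i : s i = i ->
  #|'Fix_rl[s]| = (#|D| * #|[set d | al s i d == d]|)%N.
Proof.
move=> si; have [card2 /(_ i si) Xi ->] := card_afix_relabel_cycle.
rewrite (bigD1 i) //= mulnC.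
rewrite (fixed_labels_cycle (G := A4)) //; last first.
  by rewrite inE As; apply/astab1P.
congr (_ * _)%N; have card1 : #|X :\ i| = 1%N.
  by have := cardsD1 i X; rewrite Xi card2 => -[].
transitivity (#|D| ^ #|X :\ i|)%N; last by rewrite card1 expn1.
rewrite -prod_nat_const; apply: eq_big => [j | j /andP[_ ji]].
  by rewrite !inE andbC.
rewrite fixed_labels_trivg ?A4_stab_cycle ?cardsT //.
by apply: contra s_neq1 => /eqP sj; rewrite (A4_fix2_eq1 As ji).
Qed.
End OneElement.

(** [s0] and [i0] only serve to name the common number of labels fixed by an
    element that stabilizes a point. *)
Lemma card_labelling_orbits_A4 s0 i0 : s0 \in A4 -> s0 != 1 -> s0 i0 = i0 ->
  (#|orbit rl A4 @: setT| * 12 =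
  #|D| ^ 4 + 8 * (#|D| * #|[set d | al s0 i0 d == d]|) + 3 * #|D| ^ 2)%N.
Proof.
move=> As0 s0_neq1 s0i0; set t := #|[set d | _]|.
have [D0|D_gt0] := posnP #|D|.
  rewrite D0 !muln0 /=; apply/eqP; rewrite muln_eq0 cards_eq0 orbF.
  rewrite -subset0; apply/subsetP=> O /imsetP[f].
  by have := fintype0 (f ord0); rewrite D0.
have t_const s i : s \in A4 -> s != 1 -> s i = i ->
    #|[set d | al s i d == d]| = t.
  have stab u j : u \in A4 -> u != 1 -> u j = j ->
      [set d | al u j d == d] = fixed_labels 'P al A4 j.
    move=> Au u_neq1 uj; have Cu : u \in 'C_A4[j | 'P].
      by rewrite inE Au; apply/astab1P.
    rewrite -(fixed_labels_cycle (to := 'P) al1 alM Cu).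
    rewrite /fixed_labels (A4_stab_gen Cu) //.
    by rewrite -setIA setIid.
  move=> As s_neq1 si; rewrite /t !stab //.
  have := atransP2 A4_trans (in_setT i0) (in_setT i); case=> g Ag ->.
  by rewrite (card_fixed_labels_act (to := 'P) al1 alM).
have := Frobenius_Cauchy (to := rl) (G := A4) (S := setT).
rewrite card_A4 => <-; last first.
  apply/subsetP=> g Ag; rewrite in_setI Ag inE.
  by apply/subsetP=> f _; rewrite !inE.
rewrite (bigD1 1) ?group1 //= setTI card_afix1_relabel -addnA; congr (_ + _)%N.
rewrite (bigID (fun s : {perm 'I_4} => [exists i, s i == i])) /=.
congr (_ + _)%N.
  rewrite -A4_card_fix -sum_nat_const; apply: eq_big => [s | s].
    by rewrite inE andbA.
  case/andP=> /andP[As s_neq1] /existsP[i /eqP si].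
  by rewrite setTI (card_afix_relabel_stab _ As s_neq1 si) // t_const.
rewrite -[in RHS]A4_card_nofix -sum_nat_const; apply: eq_big => [s | s].
  by rewrite inE andbA.
case/andP=> /andP[As s_neq1]; rewrite negb_exists => /forallP no_fix.
by rewrite setTI card_afix_relabel_nofix.
Qed.

End Count.

End Alt4.

Local Open Scope classical_set_scope.
Local Open Scope ring_scope.

(** * The vertices and the matrices that permute them *)

Section Vertices.
Variable R : realType.
Implicit Types (x y : 'cV[R]_3) (i j : 'I_4).

Lemma dotE x y : dot x y = (x^T *m y) 0 0.
Proof. by rewrite mxE; apply: eq_bigr => i _; rewrite mxE. Qed.

Lemma dotC x y : dot x y = dot y x.
Proof. by apply: eq_bigr => i _; rewrite mulrC. Qed.

Lemma dotDr x y z : dot x (y + z) = dot x y + dot x z.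
Proof. by rewrite !dotE mulmxDr mxE. Qed.

Lemma dotZr a x y : dot x (a *: y) = a * dot x y.
Proof. by rewrite !dotE -scalemxAr mxE. Qed.

Lemma dotNr x y : dot x (- y) = - dot x y.
Proof. by rewrite -scaleN1r dotZr mulN1r. Qed.

Lemma dotNl x y : dot (- x) y = - dot x y.
Proof. by rewrite dotC dotNr dotC. Qed.

Lemma dot_sumr (I : finType) x (y : I -> 'cV_3) :
  dot x (\sum_i y i) = \sum_i dot x (y i).
Proof.
by rewrite dotE mulmx_sumr summxE; apply: eq_bigr => i _; rewrite dotE.
Qed.

Lemma dot_trmul A x y : dot x (A *m y) = dot (A^T *m x) y.
Proof. by rewrite !dotE trmx_mul trmxK mulmxA. Qed.

(** Index 0 is the vertex (1,1,1), and index [k.+1] the vertex whose only positive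
    coordinate is the one of index [k]. *)
Definition vert i : 'cV[R]_3 :=
  \col_(k < 3) (if (i == 0 :> nat) || (i == k.+1 :> nat) then 1 else -1).

Lemma dot_vert i j : dot (vert i) (vert j) = if i == j then 3 else -1.
Proof.
rewrite /dot !big_ord_recl big_ord0 !mxE /=.
case: i j => [[|[|[|[|//]]]] ?] [[|[|[|[|//]]]] ?]; rewrite -val_eqE /=; ring.
Qed.

Lemma sum_vert : \sum_i vert i = 0.
Proof.
apply/matrixP=> k l; rewrite summxE !big_ord_recl big_ord0 !mxE /=.
by case: k => [[|[|[|//]]] ?] /=; ring.
Qed.

(** The rows of the 4 x 3 matrix of vertices are a tight frame: its three columns
    are orthogonal, of squared norm 4. *)
Lemma vert_frame x : x = 4^-1 *: \sum_i dot (vert i) x *: vert i.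
Proof.
apply/matrixP=> k l; rewrite mxE summxE !big_ord_recl big_ord0 !mxE.
rewrite /dot !big_ord_recl !big_ord0 !mxE /= (ord1 l).
have -> : k = nth ord0 [:: ord0; lift ord0 ord0; lift ord0 (lift ord0 ord0)] k.
  by case: k => [[|[|[|//]]] ?] /=; apply: val_inj.
by case: k => [[|[|[|//]]] ?] /=; field.
Qed.

Lemma three_neqN1 : (3 == -1 :> R) = false.
Proof. by apply/negbTE; rewrite gt_eqF // (lt_trans (ltrN10 R)). Qed.

Lemma vert_inj : injective vert.
Proof.
move=> i j eq_ij; have := dot_vert i i; rewrite {2}eq_ij dot_vert eqxx.
by case: eqP => // _ /esym/eqP; rewrite three_neqN1.
Qed.

(** The three vertices other than [vert i] span the space, because the four
    vertices do and sum to 0. *)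
Lemma eq_mx_vert i (A B : 'M[R]_3) :
  (forall j, j != i -> A *m vert j = B *m vert j) -> A = B.
Proof.
move=> eqAB.
have eq_vert j : A *m vert j = B *m vert j.
  have [->|/eqAB //] := eqVneq j i.
  have -> : vert i = - \sum_(j | j != i) vert j.
    apply/eqP; rewrite -addr_eq0.
    by have := sum_vert; rewrite (bigD1 i) //= => ->.
  by rewrite !mulmxN !mulmx_sumr; congr (- _); apply: eq_bigr => k /eqAB.
have eq_all x : A *m x = B *m x.
  rewrite (vert_frame x) -!scalemxAr !mulmx_sumr; congr (_ *: _).
  by apply: eq_bigr => j _; rewrite -!scalemxAr eq_vert.
apply/matrixP=> k l.
have := congr1 (fun x : 'cV_3 => x k 0) (eq_all (delta_mx l 0)).
by rewrite -!colE !mxE.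
Qed.

Definition vperm (s : {perm 'I_4}) : 'M[R]_3 :=
  4^-1 *: \sum_i vert (s i) *m (vert i)^T.

Lemma vperm_vert s j : vperm s *m vert j = vert (s j).
Proof.
rewrite [RHS]vert_frame /vperm -scalemxAl mulmx_suml; congr (_ *: _).
rewrite [RHS](reindex_inj (@perm_inj _ s)) /=; apply: eq_bigr => i _.
rewrite -mulmxA dot_vert (inj_eq perm_inj) -(dot_vert i j) dotE.
by rewrite {1}[(vert i)^T *m _]mx11_scalar mul_mx_scalar.
Qed.

Lemma vperm1 : vperm 1%g = 1%:M.
Proof. by apply: (@eq_mx_vert ord0) => j _; rewrite vperm_vert perm1 mul1mx. Qed.

Lemma vpermM s t : vperm (s * t)%g = vperm t *m vperm s.
Proof.
by apply: (@eq_mx_vert ord0) => j _; rewrite -mulmxA !vperm_vert permM.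
Qed.

Lemma vperm_tr s : (vperm s)^T = vperm s^-1%g.
Proof.
rewrite /vperm linearZ /= linear_sum /= [in RHS](reindex_inj (@perm_inj _ s)) /=.
by congr (_ *: _); apply: eq_bigr => i _; rewrite trmx_mul trmxK permK.
Qed.

Lemma vpermV s : vperm s^-1%g = invmx (vperm s).
Proof.
have : vperm s *m vperm s^-1%g = 1%:M by rewrite -vpermM mulVg vperm1.
by case/mulmx1_unit=> u _; rewrite -[LHS](mulKmx u) -vpermM mulVg vperm1 mulmx1.
Qed.

Lemma vperm_unit s : vperm s \in unitmx.
Proof.
have : vperm s *m vperm s^-1%g = 1%:M by rewrite -vpermM mulVg vperm1.
by case/mulmx1_unit.
Qed.

Lemma vperm_matrix_group : matrix_group [set vperm s | s in [set: {perm 'I_4}]].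
Proof.
split.
- by move=> _ [s _ <-]; apply: vperm_unit.
- by exists 1%g => //; rewrite vperm1.
- by move=> _ _ [s _ <-] [t _ <-]; exists (t * s)%g => //; rewrite vpermM.
- by move=> _ [s _ <-]; exists s^-1%g => //; rewrite vpermV.
Qed.

Lemma const1_vert : const_mx 1 = vert ord0.
Proof. by apply/matrixP=> k l; rewrite !mxE. Qed.

Let o0 : 'I_4 := @Ordinal 4 0 isT.
Let o1 : 'I_4 := @Ordinal 4 1 isT.
Let o2 : 'I_4 := @Ordinal 4 2 isT.
Let o3 : 'I_4 := @Ordinal 4 3 isT.

Lemma R0E : R0 R = vperm (tperm o1 o2).
Proof.
apply: (@eq_mx_vert o0) => j j0; rewrite vperm_vert permE /=.
apply/matrixP=> k l; rewrite !mxE !big_ord_recl big_ord0 !mxE /=.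
case: j j0 => [[|[|[|[|//]]]] ?]; rewrite -!val_eqE //= => _;
  case: k => [[|[|[|//]]] ?] /=; ring.
Qed.

Lemma R1E : R1 R = vperm (tperm o2 o3).
Proof.
apply: (@eq_mx_vert o0) => j j0; rewrite vperm_vert permE /=.
apply/matrixP=> k l; rewrite !mxE !big_ord_recl big_ord0 !mxE /=.
case: j j0 => [[|[|[|[|//]]]] ?]; rewrite -!val_eqE //= => _;
  case: k => [[|[|[|//]]] ?] /=; ring.
Qed.

Lemma R2E : R2 R = vperm (tperm o0 o3).
Proof.
apply: (@eq_mx_vert o2) => j j0; rewrite vperm_vert permE /=.
apply/matrixP=> k l; rewrite !mxE !big_ord_recl big_ord0 !mxE /=.
case: j j0 => [[|[|[|[|//]]]] ?]; rewrite -!val_eqE //= => _;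
  case: k => [[|[|[|//]]] ?] /=; ring.
Qed.

Lemma det_vperm_gens :
  [/\ \det (R0 R) = -1, \det (R1 R) = -1 & \det (R2 R) = -1].
Proof.
by split; rewrite (expand_det_row _ ord0) !big_ord_recl big_ord0 /cofactor
  !(expand_det_row _ ord0) !big_ord_recl !big_ord0 /cofactor !det_mx11 !mxE /=;
  ring.
Qed.

Lemma Td_sub_vperm : Td R `<=` [set vperm s | s in [set: {perm 'I_4}]].
Proof.
move=> A; apply; split; first exact: vperm_matrix_group.
by move=> B [->|[->|->]]; rewrite ?R0E ?R1E ?R2E; eexists.
Qed.

Lemma Td_matrix_group : matrix_group (Td R).
Proof.
split=> [A TdA||A B TdA TdB G GS|A TdA G GS].
- by have [s _ <-] := Td_sub_vperm TdA; apply: vperm_unit.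
- by move=> G [[]].
- by have [[_ _ GM _] _] := GS; apply: GM; [apply: TdA|apply: TdB].
- by have [[_ _ _ GV] _] := GS; apply: GV; apply: TdA.
Qed.

(** The permutations with these two properties form a group, which contains the
    transpositions of 2 with 1, 3 and, by conjugation, 0; these generate
    everything. *)
Lemma Td_det_vperm (s : {perm 'I_4}) :
  Td R (vperm s) /\ \det (vperm s) = (-1) ^+ s.
Proof.
have [_ Td1 TdM _] := Td_matrix_group; have [d0 d1 d2] := det_vperm_gens.
pose K := [set t : {perm 'I_4} |
  `[< Td R (vperm t) /\ \det (vperm t) = (-1) ^+ t >]]%SET.
have KP t : reflect (Td R (vperm t) /\ \det (vperm t) = (-1) ^+ t) (t \in K).
  by rewrite inE; apply: asboolP.
have groupK : group_set K.
  apply/group_setP; split.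
    by apply/KP; rewrite vperm1 odd_perm1 det1.
  move=> t u /KP[Tt dt] /KP[Tu du]; apply/KP; rewrite vpermM; split.
    exact: TdM.
  by rewrite det_mulmx dt du odd_permM signr_addb mulrC.
have gens : [/\ tperm o1 o2 \in K, tperm o2 o3 \in K & tperm o0 o3 \in K].
  split; apply/KP; rewrite -?R0E -?R1E -?R2E odd_tperm ?d0 ?d1 ?d2 expr1;
    by split=> // G [_ sG]; apply: sG; rewrite /=; tauto.
have [K12 K23 K03] := gens.
apply/KP; rewrite -[K]/(gval (Group groupK)).
suff : [set: {perm 'I_4}]%SET \subset Group groupK.
  by move/fintype.subsetP; apply; rewrite inE.
rewrite -(gen_tperm o2) gen_subG; apply/fintype.subsetP=> _ /imsetP[j _ ->].
case: j => [[|[|[|[|//]]]] lt].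
- have -> : Ordinal lt = o0 by apply: val_inj.
  have -> : tperm o2 o0 = (tperm o2 o3 ^ tperm o0 o3)%g.
    by rewrite tpermJ tpermR tpermD.
  by rewrite groupJ.
- have -> : Ordinal lt = o1 by apply: val_inj.
  by rewrite tpermC.
- have -> : Ordinal lt = o2 by apply: val_inj.
  by rewrite tperm1 group1.
- by have -> : Ordinal lt = o3 by apply: val_inj.
Qed.

Lemma TdE : Td R = [set vperm s | s in [set: {perm 'I_4}]].
Proof.
apply/seteqP; split=> [|_ [s _ <-]]; first exact: Td_sub_vperm.
by have [] := Td_det_vperm s.
Qed.

Lemma TE : T R = [set vperm s | s in [set s | s \in ('Alt_('I_4))%g]].
Proof.
apply/seteqP; split=> [A [] |_ [s /= As <-]].
  rewrite TdE => -[s _ <-] det1; exists s => //=; rewrite Alt_even.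
  apply: contra_eqN det1 => odd_s; have [_ ->] := Td_det_vperm s.
  by rewrite odd_s expr1 lt_eqF //; apply: lt_trans ltr01; rewrite ltrN10.
have [Tds dets] := Td_det_vperm s; split=> //.
by move: As; rewrite Alt_even dets => /negPf->.
Qed.

(** * The tetrahedron and its faces *)

Lemma convex_setE (C : set 'cV[R]_3) x y (t : R) :
  @convex_set R 'cV[R]_3 C -> C x -> C y -> 0 <= t -> t <= 1 ->
  C (t *: x + (1 - t) *: y).
Proof.
move=> cC Cx Cy t0 t1; have := cC x y (Itv01 t0 t1).
by rewrite !inE; apply.
Qed.

Lemma convex_set_sum (C : set 'cV[R]_3) (p : 'I_4 -> 'cV[R]_3) (w : 'I_4 -> R) :
  @convex_set R 'cV[R]_3 C -> (forall i, C (p i)) -> (forall i, 0 <= w i) ->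
  \sum_i w i = 1 -> C (\sum_i w i *: p i).
Proof.
move=> cC Cp w_ge0 w1.
(* for partial sums, a multiple of a point of [C] avoids dividing by a total
   weight that may vanish *)
suff comb (r : seq 'I_4) : exists2 y, C y &
    \sum_(i <- r) w i *: p i = (\sum_(i <- r) w i) *: y.
  by have [y Cy ->] := comb (index_enum 'I_4); rewrite w1 scale1r.
elim: r => [|i r [y Cy IHr]].
  by exists (p ord0) => //; rewrite !big_nil scale0r.
rewrite !big_cons {}IHr; set t := \sum_(j <- r) w j.
have t_ge0 : 0 <= t by apply: sumr_ge0.
have [s0 | s_neq0] := eqVneq (w i + t) 0.
  have /andP[/eqP wi0 /eqP t0] : (w i == 0) && (t == 0) by rewrite -paddr_eq0 ?s0.
  by exists (p i) => //; rewrite wi0 t0 addr0 !scale0r addr0.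
have s_gt0 : 0 < w i + t by rewrite lt0r s_neq0 addr_ge0.
exists ((w i / (w i + t)) *: p i + (1 - w i / (w i + t)) *: y).
  apply: convex_setE => //; first by rewrite divr_ge0 // ltW.
  by rewrite ler_pdivrMr // mul1r lerDl.
rewrite scalerDr !scalerA; congr (_ *: _ + _ *: _); by field.
Qed.

(** The barycentric coordinates of [x] are the [(dot (vert i) x + 1) / 4]. They
    add up to 1, and the inequalities say that they are nonnegative. *)
Lemma tetrahedronP x :
  tetrahedron R x <-> forall i, -1 <= dot (vert i) x.
Proof.
split=> [Px | x_ge C [cC sC]].
  apply: (Px [set y | forall i, -1 <= dot (vert i) y]).
  split=> [y z t|_ [A TdA <-] i].
    rewrite !inE => y_ge z_ge i /=.
    rewrite [dot _ _](_ : _ =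
      t%:num * dot (vert i) y + (1 - t%:num) * dot (vert i) z).
      have t0 : 0 <= t%:num by [].
      have t1 : t%:num <= 1 by apply: le1.
      have := y_ge i; have := z_ge i. clear -t0 t1. nra.
    by rewrite -!dotZr -dotDr.
  have [s _ <-] := Td_sub_vperm TdA.
  rewrite const1_vert vperm_vert dot_vert; case: eqP => // _.
  by apply: (@le_trans _ _ 0); rewrite ?lerN10.
have bary : x = \sum_i (4^-1 * (dot (vert i) x + 1)) *: vert i.
  under eq_bigr => i _ do rewrite -scalerA scalerDl scale1r.
  by rewrite -scaler_sumr big_split /= sum_vert addr0; apply: vert_frame.
rewrite bary; apply: convex_set_sum => //.
- move=> i; apply: sC; have [Tds _] := Td_det_vperm (tperm ord0 i).
  exists (vperm (tperm ord0 i)) => //.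
  by rewrite const1_vert vperm_vert tpermL.
- by move=> i; have := x_ge i; lra.
rewrite -mulr_sumr big_split /= sumr_const card_ord.
have -> : \sum_i dot (vert i) x = 0.
  under eq_bigr do rewrite dotC.
  by rewrite -dot_sumr sum_vert -(scale0r 0) dotZr mul0r.
by field.
Qed.

(** The product of the two matrices, of sizes 2 x 3 and 3 x 2, is [4%:M]. *)
Lemma vert_rank (k l m : 'I_4) : k != l -> k != m -> l != m ->
  \rank (col_mx (vert k)^T (vert l)^T) = 2%N /\
  \rank (row_mx (vert k - vert m) (vert l - vert m)) = 2%N.
Proof.
move=> kl km lm.
set A := col_mx _ _; set B := row_mx _ _.
have prod4 : A *m B = 4%:M.
  have entry i j : (vert i)^T *m (vert j - vert m) =
      (dot (vert i) (vert j) - dot (vert i) (vert m))%:M.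
    by rewrite [LHS]mx11_scalar -dotE dotDr dotNr.
  rewrite mul_col_row !entry !dot_vert !eqxx (negPf kl) (negPf km) (negPf lm).
  rewrite eq_sym (negPf kl) scalar_mx_block subrr raddf0.
  by have -> : 3 - -1 = 4 :> R by ring.
have rank4 : \rank (4%:M : 'M[R]_(1 + 1)) = 2%N.
  by rewrite -scalemx1 mxrank_scale_nz ?mxrank1 // pnatr_eq0.
split; apply/eqP; rewrite eqn_leq; apply/andP; split.
- exact: (rank_leq_row A).
- by apply: leq_trans (mxrankM_maxl _ B); rewrite prod4 rank4.
- exact: (rank_leq_col B).
- by apply: leq_trans (mxrankM_maxr A _); rewrite prod4 rank4.
Qed.

Lemma tetrahedron_vert i : tetrahedron R (vert i).
Proof.
apply/tetrahedronP=> k; rewrite dot_vert; case: ifP => // _.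
by apply: (@le_trans _ _ 0); rewrite ?lerN10.
Qed.

(** This is the facet opposite to [vert i]. *)
Definition facet i : set 'cV[R]_3 :=
  [set x | tetrahedron R x /\ dot (vert i) x = -1].

Lemma facet_vert i j : facet i (vert j) <-> i != j.
Proof.
rewrite /facet /= dot_vert; split=> [[_ /eqP]|ij].
  by case: (i =P j) => // _; rewrite three_neqN1.
by rewrite (negPf ij); split; first exact: tetrahedron_vert.
Qed.

Lemma facet_inj : injective facet.
Proof.
move=> i j eq_ij; apply/eqP; apply: contraT => /facet_vert.
by rewrite eq_ij => /facet_vert; rewrite eqxx.
Qed.

Lemma facet_is_face i : is_face (tetrahedron R) (facet i).
Proof.
split.
  exists (- vert i), 1; split.
  - rewrite oppr_eq0; apply/eqP=> v0; have /eqP := dot_vert i i.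
    by rewrite eqxx v0 dotE mulmx0 mxE eq_sym pnatr_eq0.
  - by move=> x /tetrahedronP/(_ i); rewrite dotNl; lra.
  - by apply/seteqP; split=> x [Px dx]; split=> //; move: dx; rewrite dotNl; lra.
have pick3 : exists k l m : 'I_4,
    [&& i != k, i != l, i != m, k != l, k != m & l != m].
  case: i => [[|[|[|[|//]]]] lt].
  - by exists (@Ordinal 4 1 isT), (@Ordinal 4 2 isT), (@Ordinal 4 3 isT).
  - by exists (@Ordinal 4 0 isT), (@Ordinal 4 2 isT), (@Ordinal 4 3 isT).
  - by exists (@Ordinal 4 0 isT), (@Ordinal 4 1 isT), (@Ordinal 4 3 isT).
  - by exists (@Ordinal 4 0 isT), (@Ordinal 4 1 isT), (@Ordinal 4 2 isT).
have [k [l [m /and5P[ik il im kl /andP[km lm]]]]] := pick3.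
exists (vert m), (vert k), (vert l); split; try exact/facet_vert.
by have [] := vert_rank kl km lm.
Qed.

(** Let [dot a x <= b] support the face and [g i >= 0] be the slack of [vert i].
    The slack of a point is the average of the [g i] weighted by its barycentric
    coordinates, so a coordinate with [g i != 0] vanishes on the face. Not every
    [g i] is 0, as [a != 0]; and if two of them were not, then the face would
    satisfy two independent linear equations and lie on a line. *)
Lemma face_is_facet F : is_face (tetrahedron R) F -> exists i, F = facet i.
Proof.
case=> -[a [b [a_neq0 le_b ->]]] [x [y [z [Fx Fy Fz rank2]]]].
pose g i := b - dot a (vert i).
have g_ge0 i : 0 <= g i by rewrite subr_ge0 le_b //; apply: tetrahedron_vert.
have bary w : b - dot a w = \sum_i 4^-1 * (dot (vert i) w + 1) * g i.
  by rewrite /g /dot !big_ord_recl !big_ord0 !mxE /=; field.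
have vanish w i :
    tetrahedron R w -> dot a w = b -> g i != 0 -> dot (vert i) w = -1.
  move=> Pw aw gi; have := bary w; rewrite aw subrr => /esym/eqP.
  rewrite psumr_eq0 => [/allP/(_ i)|j _]; last first.
    by have /tetrahedronP/(_ j) := Pw; have := g_ge0 j; nra.
  rewrite mem_index_enum => /(_ isT); rewrite !mulf_eq0 (negPf gi) orbF.
  by rewrite invr_eq0 pnatr_eq0 /= addr_eq0 => /eqP.
have [k gk] : exists k, g k != 0.
  apply/existsP; apply: contraR a_neq0; rewrite negb_exists => /forallP g0.
  have dot_a i : dot (vert i) a = b.
    by have := g0 i; rewrite negbK /g subr_eq0 eq_sym dotC => /eqP.
  rewrite (vert_frame a); under eq_bigr do rewrite dot_a.
  by rewrite -scaler_sumr sum_vert !scaler0.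
have g_other l : l != k -> g l = 0.
  move=> lk; apply/eqP; apply: contra_eqT rank2 => gl.
  have kl : k != l by rewrite eq_sym.
  have [m /andP[km lm]] : exists m : 'I_4, (k != m) && (l != m).
    apply/existsP; apply: contraT; rewrite negb_exists => /forallP no_m.
    have : [set: 'I_4]%SET \subset [set k; l]%SET.
      apply/fintype.subsetP=> m _; have := no_m m.
      by rewrite !inE negb_and !negbK ![_ == m]eq_sym.
    by move/subset_leq_card; rewrite cardsT card_ord cards2 kl.
  have [rank_kl _] := vert_rank kl km lm.
  have orth u v i : g i != 0 -> tetrahedron R u -> dot a u = b ->
      tetrahedron R v -> dot a v = b -> (vert i)^T *m (v - u) = 0.
    move=> gi Pu au Pv av; rewrite [LHS]mx11_scalar -dotE dotDr dotNr.
    by rewrite !(vanish _ i) // subrr raddf0.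
  have [[Px ax] [Py ay] [Pz az]] := And3 Fx Fy Fz.
  have prod0 : col_mx (vert k)^T (vert l)^T *m row_mx (y - x) (z - x) = 0.
    by rewrite mul_col_row !orth // block_mx0.
  have := mulmx0_rank_max prod0; rewrite rank_kl.
  by case: (\rank (row_mx _ _)) => [|[|[|n]]].
exists k; apply/seteqP; split=> w [Pw dw]; split=> //; first exact: vanish.
apply/esym/eqP; rewrite -subr_eq0 bary (bigD1 k) //= dw addNr mulr0 mul0r add0r.
by rewrite big1 // => i /g_other ->; rewrite mulr0.
Qed.

End Vertices.

Arguments vert : clear implicits.
Arguments vperm : clear implicits.
Arguments facet : clear implicits.

Local Notation A4 := ('Alt_('I_4))%g.

(** * Tilings as labellings of the four facets *)

Section TilingsAsLabellings.
Variables (R : realType) (D : finType).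
Variable S : tile_designs (T R) (tetrahedron R) D.
Implicit Types (s t : {perm 'I_4}) (i j : 'I_4) (d : D).
Implicit Types tau : @tiling R (tetrahedron R) D.

(** [vperm s] is orthogonal, with transpose [vperm s^-1]. *)
Lemma vperm_facet s i :
  [set vperm R s *m x | x in facet R i] = facet R (s i).
Proof.
have sub t j x : facet R j x -> facet R (t j) (vperm R t *m x).
  have dot_t k y : dot (vert R k) (vperm R t *m y) = dot (vert R (t^-1%g k)) y.
    by rewrite dot_trmul vperm_tr vperm_vert.
  case=> /tetrahedronP Px dx; split; last by rewrite dot_t permK.
  by apply/tetrahedronP=> k; rewrite dot_t.
apply/seteqP; split=> [_ [x Fx <-]|x Fx]; first exact: sub.
exists (vperm R s^-1%g *m x); first by rewrite -[i](permK s); apply: sub.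
by rewrite mulmxA -vpermM mulVg vperm1 mul1mx.
Qed.

Definition facet_face i : face (tetrahedron R) :=
  exist _ (facet R i) (@facet_is_face R i).

Lemma face_inj : injective (fun F : face (tetrahedron R) => sval F).
Proof.
move=> [F faceF] [F' faceF'] /= eqF; subst F'.
by congr (exist _ F _); apply: Prop_irrelevance.
Qed.

Lemma facet_face_inj : injective facet_face.
Proof.
move=> i j eq_ij; apply: (@facet_inj R).
by rewrite -[LHS]/(sval (facet_face i)) eq_ij.
Qed.

Lemma facet_face_surj F : exists i, F = facet_face i.
Proof.
by have [i Fi] := face_is_facet (svalP F); exists i; apply: face_inj.
Qed.

Lemma T_vperm s : s \in A4 -> T R (vperm R s).
Proof. by move=> As; rewrite TE; exists s. Qed.

Definition carry s i d : D := (Defs.act S (vperm R s) (d, facet_face i)).1.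

Lemma act_vperm s i d : s \in A4 ->
  Defs.act S (vperm R s) (d, facet_face i) = (carry s i d, facet_face (s i)).
Proof.
move=> As; rewrite [LHS]surjective_pairing; congr (_, _); apply: face_inj.
by rewrite act_face /= ?vperm_facet //; apply: T_vperm.
Qed.

Lemma carry1 i d : carry 1%g i d = d.
Proof. by rewrite /carry vperm1 Defs.act1. Qed.

Lemma carryM : {in A4 &, forall s t i d,
  carry (s * t)%g i d = carry t (s i) (carry s i d)}.
Proof.
move=> s t As At i d.
by rewrite /carry vpermM Defs.actM ?act_vperm //; apply: T_vperm.
Qed.

Notation rl := (relabel_action (to := 'P) carry1 carryM).

Definition labels tau : {ffun 'I_4 -> D} := [ffun i => tau (facet_face i)].

Lemma labels_surj f : exists tau, labels tau = f.
Proof.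
exists (fun F => f (sval (cid (facet_face_surj F)))); apply/ffunP=> i.
rewrite ffunE; congr (f _); case: cid => j /= eq_ij.
by apply: facet_face_inj.
Qed.

Lemma tiling_orbitP tau tau' :
  tiling_orbit S tau tau' <-> labels tau' \in orbit rl A4 (labels tau).
Proof.
split=> [[A TA eq_graph] | /orbitP[s As eq_labels]].
  have [s /= As defA] : [set vperm R s | s in [set s | s \in A4]] A.
    by rewrite -TE.
  rewrite -defA in eq_graph; apply/orbitP; exists s => //.
  change (relabel 'P A4 carry (labels tau) s = labels tau').
  apply/ffunP=> i; rewrite -[i](permKV s); set j := (s^-1)%g i.
  have := relabelE 'P carry (labels tau) j As; rewrite /= /aperm => ->.
  rewrite !ffunE.
  have : graph tau' (Defs.act S (vperm R s) (tau (facet_face j), facet_face j)).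
    rewrite eq_graph; exists (tau (facet_face j), facet_face j) => //.
    by exists (facet_face j).
  by rewrite act_vperm // => -[F _ [<- <-]].
have lab i : tau' (facet_face (s i)) = carry s i (tau (facet_face i)).
  have := congr1 (fun f : {ffun 'I_4 -> D} => f (s i)) eq_labels.
  have := relabelE 'P carry (labels tau) i As; rewrite /= /aperm => ->.
  by rewrite !ffunE.
exists (vperm R s); first exact: T_vperm.
apply/seteqP; split=> [_ [F _ <-] | _ [_ [F _ <-] <-]].
  have [i ->] := facet_face_surj F.
  exists (tau (facet_face (s^-1%g i)), facet_face (s^-1%g i)).
    by exists (facet_face (s^-1%g i)).
  by rewrite act_vperm // -lab permKV.
have [i ->] := facet_face_surj F.
by rewrite act_vperm // -lab; exists (facet_face (s i)).
Qed.

Lemma card_tiling_orbits :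
  (tiling_orbits S #= `I_#|orbit rl A4 @: [set: {ffun 'I_4 -> D}]%SET|)%card.
Proof.
set O := orbit rl A4 @: _.
pose lift_orbit (X : {set {ffun 'I_4 -> D}}) :
  set (@tiling R (tetrahedron R) D) := [set tau | labels tau \in X].
have lift_inj : injective lift_orbit.
  move=> X X' eq_X; apply/setP=> f; have [tau <-] := labels_surj f.
  have := congr1 (fun U => U tau) eq_X; rewrite /lift_orbit /= => e.
  by apply/idP/idP; rewrite e.
have -> : tiling_orbits S =
    (fun k : 'I_#|O| => lift_orbit (enum_val k)) @` [set: 'I_#|O|].
  apply/seteqP; split=> [_ [tau _ <-] | _ [k _ <-]].
    have Otau : orbit rl A4 (labels tau) \in O by apply: imset_f.
    exists (enum_rank_in Otau (orbit rl A4 (labels tau))) => //.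
    rewrite enum_rankK_in //.
    by apply/seteqP; split=> tau' /tiling_orbitP.
  have /imsetP[f _ ->] := enum_valP k.
  have [tau <-] := labels_surj f; exists tau => //.
  by apply/seteqP; split=> tau' /tiling_orbitP.
rewrite card_eq_sym; apply: card_eq_trans card_II _; rewrite card_eq_sym.
by apply: inj_card_eq => k k' _ _ /lift_inj/enum_val_inj.
Qed.

End TilingsAsLabellings.

(** * The third of a turn and the designs that it fixes *)

Section RotationsOfAFace.
Variable R : realType.

Lemma sin_third_turn_gt0 : 0 < sin (2 * pi / 3 : R).
Proof.
have pi0 := pi_gt0 R; apply: sin_gt0_pi.
apply/andP; split; lra.
Qed.

(** A rotation by an angle of nonzero sine fixes only its centre: the coordinates
    of a fixed point in the frame are a vector killed by a matrix of determinant
    [(1 - cos) ^+ 2 + sin ^+ 2]. *)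
Lemma third_turn_id_eq (F : set 'cV[R]_3) (r : F -> F) :
  rotation_by (2 * pi / 3) r -> (forall x, r x = x) -> forall x y : F, x = y.
Proof.
case=> c [u [v [uu vv uv rot]]] r_id.
have at_c (x : F) : val x = c.
  have [a [b [xE]]] := rot x; rewrite r_id xE.
  set co := cos _; set si := sin _ => eq_xy.
  have eq_dot w : dot w (a *: u + b *: v) =
      dot w ((a * co - b * si) *: u + (a * si + b * co) *: v).
    by congr (dot w _); apply: (addrI c); rewrite !addrA.
  have := eq_dot u; have := eq_dot v.
  rewrite !dotDr !dotZr uu vv uv dotC uv !mulr0 !mulr1 !addr0 !add0r => eb ea.
  have si_gt0 : 0 < si := sin_third_turn_gt0.
  have det_gt0 : 0 < (1 - co) ^+ 2 + si ^+ 2.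
    by rewrite ltr_wpDl ?sqr_ge0 // exprn_gt0.
  have a0 : a = 0.
    apply: (mulIf (lt0r_neq0 det_gt0)); rewrite mul0r.
    transitivity
      ((a - (a * co - b * si)) * (1 - co) - (b - (a * si + b * co)) * si).
      by ring.
    by rewrite -ea -eb !subrr !mul0r subrr.
  have b0 : b = 0.
    apply: (mulIf (lt0r_neq0 det_gt0)); rewrite mul0r.
    transitivity
      ((b - (a * si + b * co)) * (1 - co) + (a - (a * co - b * si)) * si).
      by ring.
    by rewrite -ea -eb !subrr !mul0r addr0.
  by rewrite a0 b0 !scale0r !addr0.
by move=> x y; apply: val_inj; rewrite !at_c.
Qed.

End RotationsOfAFace.

Section FixedDesigns.
Variables (R : realType) (D : finType).
Variable S : tile_designs (T R) (tetrahedron R) D.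

(** The matrix is unique because [r] prescribes its values on the three vertices
    of [F]. *)
Lemma induces_vperm (F : face (tetrahedron R)) (r : sval F -> sval F) :
  induced_symmetry (T R) r ->
  exists s i, [/\ s \in A4, s i = i, F = facet_face R i
    & forall A, induces (T R) A r <-> A = vperm R s].
Proof.
have [i Fi] := facet_face_surj F; subst F => -[A [TA AF rA]].
have [s /= As defA] : [set vperm R s | s in [set s | s \in A4]] A.
  by rewrite -TE.
subst A; rewrite vperm_facet in AF.
exists s, i; split=> //; first exact: facet_inj AF.
move=> B; split=> [[TB BF rB] | ->]; last by split; rewrite ?vperm_facet.
apply: (@eq_mx_vert R i) => j ji.
have Fj : vert R j \in facet R i.
  by rewrite inE; apply/facet_vert; rewrite eq_sym.
by have := rB (exist _ (vert R j) Fj); rewrite rA /= => <-.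
Qed.

Lemma fixed_designs_vperm s i (r : facet R i -> facet R i) :
  s \in A4 -> s i = i -> (forall A, induces (T R) A r <-> A = vperm R s) ->
  fixed_designs S (F := facet_face R i) r = [set d | carry S s i d == d]%SET.
Proof.
move=> As si ind_r; apply/setP=> d; rewrite !inE.
apply/asboolP/eqP=> [[A [/ind_r -> +]] | fix_d].
  by rewrite act_vperm // => -[].
exists (vperm R s); split; first exact/ind_r.
by rewrite act_vperm // fix_d si.
Qed.

(** If [s] were 1, then [r] would be the identity and the face reduced to the
    centre of the rotation. *)
Lemma rotation_vperm_neq1 s i (r : facet R i -> facet R i) :
  rotation_by (2 * pi / 3) r -> induces (T R) (vperm R s) r -> s != 1%g.
Proof.
move=> rot_r [_ _ rE]; apply/eqP=> s1.
have r_id x : r x = x by apply: val_inj; rewrite rE s1 vperm1 mul1mx.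
have Fj j : i != j -> vert R j \in facet R i by rewrite inE => /facet_vert.
have [j [k [ij ik jk]]] : exists j k, [/\ i != j, i != k & j != k].
  exists (if i == ord0 then lift ord0 ord0 else ord0).
  exists (if i == ord_max then lift ord0 ord0 else ord_max).
  by case: i {r rot_r rE r_id Fj} => [[|[|[|[|//]]]] ?].
have := third_turn_id_eq rot_r r_id
  (exist _ (vert R j) (Fj j ij)) (exist _ (vert R k) (Fj k ik)).
by move/(congr1 val)/vert_inj/eqP; rewrite (negPf jk).
Qed.

End FixedDesigns.

Theorem corollary1 (R : realType) (D : finType)
    (S : tile_designs (T R) (tetrahedron R) D)
    (F : face (tetrahedron R)) (r : sval F -> sval F) (t_id t_r : nat)
    (r_sym : induced_symmetry (T R) r)
    (r_rot : rotation_by (2 * pi / 3) r)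
    (card_D : #|D| = t_id)
    (card_fixed : #|fixed_designs S r| = t_r) :
  exists n : nat,
    (tiling_orbits S #= `I_n)%card /\
    n%:R = 12^-1 * (t_id%:R ^+ 4 + 8 * t_id%:R * t_r%:R + 3 * t_id%:R ^+ 2)
      :> rat.
Proof.
have [s [i [As si defF ind_r]]] := induces_vperm r_sym; subst F.
have s_neq1 : s != 1%g by apply: rotation_vperm_neq1 r_rot _; apply/ind_r.
have := card_labelling_orbits_A4 (carry1 S) (carryM S) As s_neq1 si.
rewrite -(fixed_designs_vperm S As si ind_r) card_fixed card_D => count.
eexists; split; first exact: card_tiling_orbits.
have := congr1 (fun k => k%:R : rat) count.
by rewrite !(natrM, natrD, natrX); lra.
Qed.
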